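(* Let $k\ge2$, $\tau>0$, $n\ge0$, let $u_i^n\in H^1(\Omega)$, $i\in[k]$, be given, and suppose that $u_i^{n+1}\in H^1(\Omega)$, $i\in[k]$, is obtained by solving the following scheme: Step 1: $\tilde u_i^{n+1}=e^{\tau\Delta}u_i^n$ for $i\in[k]$. Step 2: $(\bar u_i^{n+1},\lambda_i^{n+1},\eta_i^{n+1})$ solve $$\frac{\bar u_i^{n+1}-\tilde u_i^{n+1}}{\tau}=\lambda_i^{n+1}+\sum_{j=1}^{k-1}\eta_j^{n+1}u_j^n,\quad i\in[k-1],$$ $$\bar u_i^{n+1}\bar u_j^{n+1}=0,\quad i,j\in[k],\ j\ne i,\qquad \bar u_i^{n+1}\ge0,\ \lambda_i^{n+1}\ge0,\ \lambda_i^{n+1}\bar u_i^{n+1}=0,\quad i\in[k].$$ Step 3: $\hat u_i^{n+1}=\bar u_i^{n+1}/\|\bar u_i^{n+1}\|$ for $i\in[k]$. Step 4: $u_i^{n+1}$, $i\in[k]$, and the real number $\sigma^{n+1}$ solve $$u_i^{n+1}=\frac{\hat u_i^{n+1}+\Psi[\hat u_i^{n+1},\sigma^{n+1}]\sigma^{n+1}}{\|\hat u_i^{n+1}+\Psi[\hat u_i^{n+1},\sigma^{n+1}]\sigma^{n+1}\|},\quad i\in[k],\qquad \frac{E^{n+1}-E^n}{\tau}=-\frac1{\tau^2}\sum_{i=1}^k\|u_i^{n+1}-u_i^n\|^2 .$$ Then the scheme is positivity-preserving and orthogonality-preserving, i.e. $$u_i^{n+1}\ge0,\qquad u_i^{n+1}u_j^{n+1}=0,\qquad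 i,j\in[k],\ j\neq i,$$ and it is energy dissipative with respect to time, in the sense that $$\frac{E^{n+1}-E^n}{\tau}=-\frac{1}{\tau^2}\sum_{i=1}^k\|u_i^{n+1}-u_i^n\|^2 .$$
   Context: $\Omega\subset\mathbb{R}^d$ is a bounded smooth domain (or a periodic box), $[k]=\{1,\dots,k\}$, and $\|\cdot\|$ is the $L^2(\Omega)$ norm. $e^{\tau\Delta}$ is the solution operator at time $\tau$ of the heat equation $\partial_tv=\Delta v$ on $\Omega$ with the chosen (periodic, homogeneous Dirichlet or homogeneous Neumann) boundary conditions. The energy is $E^n=\frac12\sum_{i=1}^k\int_\Omega|\nabla u_i^n|^2\,dx$. For a function $v$ on $\Omega$ and $\sigma\in\mathbb{R}$, $\Psi[v,\sigma](x)=1$ if $v(x)>0$ and $v(x)+\sigma>0$, and $\Psi[v,\sigma](x)=0$ otherwise. The multipliers $\lambda_i^{n+1},\eta_i^{n+1}$ are real-valued functions on $\Omega$. The norms appearing in denominators are assumed nonzero. Pointwise identities and inequalities are understood almost everywhere in $\Omega$. The theorem concerns solutions of the scheme; existence of a solution is not asserted. *)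

(* Defs.v *)
From HB Require Import structures.
From mathcomp Require Import all_boot all_order all_algebra.
From mathcomp Require Import all_classical all_reals all_analysis.

Set Implicit Arguments.
Unset Strict Implicit.
Unset Printing Implicit Defensive.

Import Order.TTheory GRing.Theory Num.Theory.
Import numFieldNormedType.Exports.

Local Open Scope classical_set_scope.
Local Open Scope ring_scope.

(* The sigma-algebra on ['rV[R]_n] generated by the coordinates is the Borel
   one. *)
Definition rV_display : measure_display.
Proof. exact: default_measure_display. Qed.

Section measurable_rV.
Context {R : realType} (n : nat).

Let coords (i : 'I_n) (x : 'rV[R]_n) : measurableTypeR R := x ord0 i.

Let rV_set0 : g_sigma_preimage coords set0.
Proof. exact: sigma_algebra0. Qed.

Let rV_setC A : g_sigma_preimage coords A -> g_sigma_preimage coords (~` A).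
Proof. exact: sigma_algebraC. Qed.

Let rV_bigcup (F : (set 'rV[R]_n)^nat) :
  (forall i, g_sigma_preimage coords (F i)) ->
  g_sigma_preimage coords (\bigcup_i (F i)).
Proof. exact: sigma_algebra_bigcup. Qed.

HB.instance Definition _ := @isMeasurable.Build
  rV_display 'rV[R]_n
  (g_sigma_preimage coords) rV_set0 rV_setC rV_bigcup.

Lemma measurable_coord (i : 'I_n) :
  measurable_fun [set: 'rV[R]_n] (fun x => x ord0 i : measurableTypeR R).
Proof.
move=> _ Y mY; rewrite setTI; apply: sub_sigma_algebra => /=.
rewrite -bigcup_seq/=; exists i => /=; first by rewrite mem_index_enum.
by exists Y => //; rewrite setTI.
Qed.

Lemma measurable_fun_rV d (T : measurableType d) (f : T -> 'rV[R]_n) :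
  (forall i, measurable_fun setT (fun t => f t ord0 i : measurableTypeR R)) ->
  measurable_fun [set: T] f.
Proof.
move=> mf _ A; rewrite setTI => mA.
pose G : set (set 'rV[R]_n) := [set B | measurable (f @^-1` B)].
suff : measurable `<=` G by apply.
apply: smallest_sub.
  split; rewrite /G /=; first by rewrite preimage_set0.
  - by move=> B mB; rewrite setTD preimage_setC; exact: measurableC.
  - by move=> F mF; rewrite preimage_bigcup; exact: bigcup_measurable.
rewrite -bigcup_seq; apply: bigcup_sub => i _ B [C mC <-].
by rewrite setTI /G/=; have := mf i measurableT _ mC; rewrite setTI.
Qed.

End measurable_rV.

Section lebesgue_rV.
Context {R : realType}.
Implicit Type n : nat.

Definition rV_cons n (p : measurableTypeR R * 'rV[R]_n) : 'rV[R]_n.+1 :=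
  row_mx (const_mx p.1 : 'rV[R]_1) p.2.

Definition rV_uncons n (x : 'rV[R]_n.+1) : measurableTypeR R * 'rV[R]_n :=
  (x ord0 ord0, \row_i x ord0 (lift ord0 i)).

Lemma rV_consK n : cancel (@rV_cons n) (@rV_uncons n).
Proof.
move=> [a x]; rewrite /rV_uncons /rV_cons; congr pair => /=.
  have -> : (ord0 : 'I_n.+1) = lshift n (ord0 : 'I_1) by exact/val_inj.
  by apply: etrans (row_mxEl _ _ _ _) _; rewrite mxE.
apply/rowP => i; rewrite mxE.
have -> : lift (ord0 : 'I_n.+1) i = rshift 1 i by exact/val_inj.
exact: row_mxEr.
Qed.

Lemma measurable_rV_cons n : measurable_fun setT (@rV_cons n).
Proof.
apply: measurable_fun_rV => i; rewrite /rV_cons.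
case: (split_ordP (i : 'I_(1 + n))) => j ->.
  rewrite [X in measurable_fun _ X](_ : _ = fst); first exact: measurable_fst.
  by apply/funext => p; apply: etrans (row_mxEl _ _ _ _) _; rewrite mxE.
rewrite [X in measurable_fun _ X](_ : _ =
  (fun x : 'rV[R]_n => x ord0 j : measurableTypeR R) \o snd).
  by apply: measurableT_comp; [exact: measurable_coord|exact: measurable_snd].
by apply/funext => p; exact: row_mxEr.
Qed.

Lemma measurable_rV_uncons n : measurable_fun setT (@rV_uncons n).
Proof.
apply/measurable_fun_pair; first exact: measurable_coord.
apply: measurable_fun_rV => i.
under eq_fun do rewrite mxE.
exact: measurable_coord.
Qed.

HB.instance Definition _ n := isMeasurableFun.Build _ _ _ _ (@rV_cons n)
  (@measurable_rV_cons n).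

Section step.
Context n (mu : {sigma_finite_measure set 'rV[R]_n -> \bar R}).

Definition lebesgue_step : set 'rV[R]_n.+1 -> \bar R :=
  pushforward (@lebesgue_measure R \x mu)%E (@rV_cons n).

Let lebesgue_step0 : lebesgue_step set0 = 0%E.
Proof. exact: measure0. Qed.

Let lebesgue_step_ge0 A : (0 <= lebesgue_step A)%E.
Proof. exact: measure_ge0. Qed.

Let lebesgue_step_sigma_additive : semi_sigma_additive lebesgue_step.
Proof. exact: measure_semi_sigma_additive. Qed.

HB.instance Definition _ := isMeasure.Build _ _ _ lebesgue_step
  lebesgue_step0 lebesgue_step_ge0 lebesgue_step_sigma_additive.

Let lebesgue_step_sigma_finite : sigma_finite setT lebesgue_step.
Proof.
have /sigma_finiteP[F [TF ndF Foo]] := sigma_finiteT (@lebesgue_measure R).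
have /sigma_finiteP[G [TG ndG Goo]] := sigma_finiteT mu.
exists (fun k => @rV_uncons n @^-1` (F k `*` G k)).
  rewrite -preimage_bigcup; apply/esym; rewrite -subTset => x _ /=.
  have [k _ Fk] : (\bigcup_k F k) (rV_uncons x).1 by rewrite -TF.
  have [l _ Gl] : (\bigcup_k G k) (rV_uncons x).2 by rewrite -TG.
  exists (maxn k l) => //; split.
  - by move: Fk; exact/subsetPset/ndF/leq_maxl.
  - by move: Gl; exact/subsetPset/ndG/leq_maxr.
move=> k; have [mF Fk] := Foo k; have [mG Gk] := Goo k; split.
  rewrite -[X in measurable X]setTI; apply: measurable_rV_uncons => //.
  exact: measurableX.
rewrite /lebesgue_step /pushforward /= -comp_preimage.
rewrite (_ : _ \o _ = id) ?preimage_id; last exact/funext/rV_consK.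
by rewrite product_measure1E// lte_mul_pinfty// ge0_fin_numE.
Qed.

HB.instance Definition _ := Measure_isSigmaFinite.Build _ _ _ lebesgue_step
  lebesgue_step_sigma_finite.
End step.

Fixpoint lebesgue_rV n : {sigma_finite_measure set 'rV[R]_n -> \bar R} :=
  if n is m.+1 then lebesgue_step (lebesgue_rV m) else \d_(0 : 'rV[R]_0).

End lebesgue_rV.

Lemma lebesgue_rV_box (R : realType) n (A : 'I_n -> set (measurableTypeR R)) :
  (forall i, measurable (A i)) ->
  lebesgue_rV n [set x : 'rV[R]_n | forall i, A i (x ord0 i)] =
  (\prod_(i < n) lebesgue_measure (A i))%E.
Proof.
elim: n A => [|n IH] A mA.
  rewrite big_ord0 /= diracE (_ : _ \in _ = true)//.
  by apply/mem_set => -[].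
rewrite big_ord_recl -IH//= /lebesgue_step /pushforward.
rewrite -product_measure1E//; last first.
  rewrite [X in measurable X](_ : _ = \big[setI/setT]_(i < n)
      ((fun x : 'rV[R]_n => x ord0 i : measurableTypeR R) @^-1` A (lift ord0 i))).
    apply: bigsetI_measurable => i _.
    by rewrite -[X in measurable X]setTI; exact: measurable_coord.
  apply/seteqP; split => [x Ax|x]; rewrite -bigcap_seq.
    by move=> i _; exact: Ax.
  by move=> Ax i; apply: (Ax i); rewrite /= mem_index_enum.
congr (_ _); apply/seteqP; split => -[a x] /= Aax.
  have E := rV_consK (a, x); split => [|i].
    by have := Aax ord0; rewrite -[X in A _ X]/((rV_uncons (rV_cons (a, x))).1) E.
  have := Aax (lift ord0 i).
  move/(congr1 snd)/rowP/(_ i) : E; rewrite /= mxE => ->//.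
have E := rV_consK (a, x); move=> i.
case: (unliftP ord0 i) => [j|] ->.
  move/(congr1 snd)/rowP/(_ j) : E; rewrite /= mxE => ->//.
  exact: (Aax.2 j).
by move/(congr1 fst) : E => /= ->; exact: Aax.1.
Qed.

Section heat_flow.
Context {R : realType} {d : nat}.
Implicit Types (f g v w phi : 'rV[R]_d -> R) (Omega : set 'rV[R]_d).

Local Notation mu := (@lebesgue_rV R d).
Local Notation e i := (delta_mx ord0 i : 'rV[R]_d).

Fixpoint Ck (m : nat) f : Prop :=
  if m is m'.+1 then
    continuous f /\
    forall i, (forall x, derivable f x (e i)) /\ Ck m' (fun x => 'D_(e i) f x)
  else continuous f.

Definition smooth f := forall m, Ck m f.

(* Near each boundary point, up to the choice of a coordinate [i] and of an
   orientation, [Omega] lies strictly on one side of the graph of a smooth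
   function of the other coordinates. *)
Definition smooth_boundary Omega := forall x0, closure Omega x0 -> ~ Omega x0 ->
  exists (i : 'I_d) (b : bool) (gamma : 'rV[R]_d -> R),
    [/\ smooth gamma,
        forall x t, gamma (x + t *: e i) = gamma x &
        \forall x \near x0, Omega x <-> gamma x < (-1) ^+ b * x ord0 i].

Definition bounded_smooth_domain Omega :=
  [/\ Omega !=set0, open Omega, connected Omega, bounded_set Omega &
      smooth_boundary Omega].

(* Domain together with its boundary condition. The periodic box is the flat
   torus obtained from the box with opposite corners [a] and [b]. *)
Inductive setting :=
  | Periodic (a b : 'rV[R]_d)
  | Dirichlet (Omega : set 'rV[R]_d)
  | Neumann (Omega : set 'rV[R]_d).

Implicit Type D : setting.

Definition domain D : set 'rV[R]_d :=
  match D with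
  | Periodic a b => [set x | forall i, a ord0 i < x ord0 i < b ord0 i]
  | Dirichlet Omega | Neumann Omega => Omega
  end.

Definition admissible D :=
  match D with
  | Periodic a b => forall i, a ord0 i < b ord0 i
  | Dirichlet Omega | Neumann Omega => bounded_smooth_domain Omega
  end.

Definition ae_on D (P : 'rV[R]_d -> Prop) :=
  {ae mu, forall x, domain D x -> P x}.

Definition integral D f : R := \int[mu]_(x in domain D) f x.

(* Functions on the domain are represented by functions on the whole space,
   whose values outside the domain are irrelevant. *)
Definition L2 D v : Prop := (v \_ (domain D)) \in Lfun mu 2%:E.

Definition L2norm D v : R := fine 'N[mu]_2%:E[EFin \o (v \_ (domain D))].

(* Smooth functions on the torus in the periodic case, smooth functions with
   compact support in the domain otherwise. *)
Definition test_function D phi :=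
  smooth phi /\
  match D with
  | Periodic a b =>
      forall i x, phi (x + (b ord0 i - a ord0 i) *: e i) = phi x
  | Dirichlet Omega | Neumann Omega =>
      exists K, [/\ compact K, K `<=` Omega & forall x, ~ K x -> phi x = 0]
  end.

Definition is_weak_partial D (i : 'I_d) v g :=
  L2 D g /\ forall phi, test_function D phi ->
    integral D (fun x => v x * 'D_(e i) phi x) =
    - integral D (fun x => g x * phi x).

Definition H1 D v := L2 D v /\ forall i, exists g, is_weak_partial D i v g.

Definition weak_partial D (i : 'I_d) v : 'rV[R]_d -> R :=
  xget (fun=> 0) [set g | is_weak_partial D i v g].

(* Written in coordinates because the library norm on ['rV[R]_d] is the sup
   norm. *)
Definition grad_dot D v w : 'rV[R]_d -> R :=
  fun x => \sum_(i < d) weak_partial D i v x * weak_partial D i w x.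

Definition H10 D v := H1 D v /\ forall eps : R, 0 < eps ->
  exists phi, [/\ test_function D phi,
    L2norm D (v \- phi) < eps &
    forall i, L2norm D (weak_partial D i v \- (fun x => 'D_(e i) phi x)) < eps].

Definition form_domain D : ('rV[R]_d -> R) -> Prop :=
  if D is Dirichlet _ then H10 D else H1 D.

(* [w] is the Laplacian of [v], where [v] satisfies the boundary condition of
   [D]: Green's formula without boundary term against the form domain. *)
Definition is_laplacian D v w :=
  [/\ form_domain D v, L2 D w &
      forall phi, form_domain D phi ->
        integral D (fun x => w x * phi x) = - integral D (grad_dot D v phi)].

(* [v] solves the heat equation on positive times with initial datum [f], the
   time derivative and the initial condition being taken in [L2]. *)
Definition heat_solution D f (v : R -> 'rV[R]_d -> R) :=
  (L2norm D (v t \- f) @[t --> 0^'+] --> (0 : R)) /\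
  forall t, 0 < t -> exists w, is_laplacian D (v t) w /\
    (L2norm D (fun x => h^-1 * (v (t + h) x - v t x) - w x) @[h --> 0^']
      --> (0 : R)).

(* The heat semigroup as the graph of an operator on almost everywhere classes:
   [g] is the value at time [tau] of the solution issued from [f]. *)
Definition heat_semigroup D (tau : R) f g :=
  exists v : R -> 'rV[R]_d -> R,
    heat_solution D f v /\ ae_on D (fun x => g x = v tau x).

Definition energy D (k : nat) (u : 'I_k -> 'rV[R]_d -> R) : R :=
  2^-1 * \sum_(i < k) integral D (grad_dot D (u i) (u i)).

Definition Psi v (sigma : R) : 'rV[R]_d -> R :=
  fun x => if (0 < v x) && (0 < v x + sigma) then 1 else 0.

Definition shifted v (sigma : R) : 'rV[R]_d -> R :=
  fun x => v x + Psi v sigma x * sigma.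

End heat_flow.

Arguments setting : clear implicits.

(* Main.v *)
Require Import Defs.
From HB Require Import structures.
From mathcomp Require Import all_boot all_order all_algebra.
From mathcomp Require Import all_classical all_reals all_analysis.

Set Implicit Arguments.
Unset Strict Implicit.
Unset Printing Implicit Defensive.

Import Order.TTheory GRing.Theory Num.Theory.
Import numFieldNormedType.Exports.

Local Open Scope classical_set_scope.
Local Open Scope ring_scope.

(** Positivity and orthogonality are built into [ubar] by Step 2, and Steps 3 and 4 act pointwise
    without destroying them. Dividing by a norm preserves signs and zeros. The shift by [sigma] acts
    only where the value is positive and stays positive ([shifted_ge0]), and never at a zero
    ([shifted_eq0]), so supports do not grow and disjoint ones stay disjoint. The energy law is the
    equation that determines [sigma] in Step 4. *)

(** Allows the almost everywhere relations of the scheme to be combined at a common point by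
    [filterS2] and [filterS3]. *)
#[local] Instance ae_on_filter (R : realType) (d : nat) (D : setting R d) :
  Filter (ae_on D).
Proof.
split; rewrite /ae_on.
- exact: filterE.
- by move=> P Q; apply: filterS2 => x Px Qx Dx; split; [exact: Px|exact: Qx].
- by move=> P Q PQ; apply: filterS => x Px Dx; exact/PQ/Px.
Qed.

Lemma L2norm_ge0 (R : realType) (d : nat) (D : setting R d) v :
  0 <= L2norm D v.
Proof. by rewrite /L2norm fine_ge0// Lnorm_ge0. Qed.

(** [sigma] may be negative: where the shift is active, the second test in [Psi] is exactly
    positivity of the result; elsewhere [v x] is unchanged. *)
Lemma shifted_ge0 (R : realType) (d : nat) (v : 'rV[R]_d -> R) sigma x :
  0 <= v x -> 0 <= shifted v sigma x.
Proof.
rewrite /shifted /Psi; case: ifP => [/andP[_ /ltW]|_ v_ge0].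
  by rewrite mul1r.
by rewrite mul0r addr0.
Qed.

(** The first test in [Psi] is strict, so it fails at a zero of [v]. *)
Lemma shifted_eq0 (R : realType) (d : nat) (v : 'rV[R]_d -> R) sigma x :
  v x = 0 -> shifted v sigma x = 0.
Proof. by rewrite /shifted /Psi => ->; rewrite ltxx mul0r addr0. Qed.

Theorem theorem3p6 (R : realType) (d k n : nat) (D : setting R d) (tau : R)
    (u : nat -> 'I_k -> 'rV[R]_d -> R)
    (utilde ubar uhat lambda eta : 'I_k -> 'rV[R]_d -> R) (sigma : R)
    (d_gt0 : (0 < d)%N) (k_ge2 : (2 <= k)%N) (tau_gt0 : 0 < tau)
    (D_admissible : admissible D)
    (u_n_H1 : forall i, H1 D (u n i))
    (u_n1_H1 : forall i, H1 D (u n.+1 i))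
    (* Step 1 *)
    (utildeE : forall i, heat_semigroup D tau (u n i) (utilde i))
    (* Step 2 *)
    (ubar_L2 : forall i, L2 D (ubar i))
    (ubarE : forall i : 'I_k, (i < k.-1)%N -> ae_on D (fun x =>
      (ubar i x - utilde i x) / tau =
      lambda i x + \sum_(j < k | (j < k.-1)%N) eta j x * u n j x))
    (ubar_orth : forall i j, j != i -> ae_on D (fun x => ubar i x * ubar j x = 0))
    (ubar_ge0 : forall i, ae_on D (fun x => 0 <= ubar i x))
    (lambda_ge0 : forall i, ae_on D (fun x => 0 <= lambda i x))
    (lambda_ubar : forall i, ae_on D (fun x => lambda i x * ubar i x = 0))
    (* Step 3 *)
    (ubar_neq0 : forall i, L2norm D (ubar i) != 0)
    (uhatE : forall i, ae_on D (fun x => uhat i x = ubar i x / L2norm D (ubar i)))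
    (* Step 4 *)
    (shifted_neq0 : forall i, L2norm D (shifted (uhat i) sigma) != 0)
    (u_n1E : forall i, ae_on D (fun x =>
      u n.+1 i x =
      shifted (uhat i) sigma x / L2norm D (shifted (uhat i) sigma)))
    (energyE : (energy D (u n.+1) - energy D (u n)) / tau =
      - (tau ^+ 2)^-1 * \sum_(i < k) L2norm D (u n.+1 i \- u n i) ^+ 2) :
  [/\ forall i, ae_on D (fun x => 0 <= u n.+1 i x),
      forall i j, j != i -> ae_on D (fun x => u n.+1 i x * u n.+1 j x = 0) &
      (energy D (u n.+1) - energy D (u n)) / tau =
        - (tau ^+ 2)^-1 * \sum_(i < k) L2norm D (u n.+1 i \- u n i) ^+ 2].
Proof.
(* The energy identity is closed here by [energyE]. *)
split=> //.
- move=> i; apply: filterS3 (ubar_ge0 i) (uhatE i) (u_n1E i).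
  move=> x ubar_x uhat_x u_x.
  rewrite u_x divr_ge0 ?L2norm_ge0// shifted_ge0// uhat_x.
  by rewrite divr_ge0 ?L2norm_ge0//.
- move=> i j ji.
  (* Zeros pass from [ubar] to the new iterate one component at a time, so it suffices to know which
     factor of the product vanishes. *)
  have vanish l : ae_on D (fun x => ubar l x = 0 -> u n.+1 l x = 0).
    apply: filterS2 (uhatE l) (u_n1E l) => x uhat_x u_x ubar_x.
    by rewrite u_x shifted_eq0 ?mul0r// uhat_x ubar_x mul0r.
  apply: filterS3 (ubar_orth _ _ ji) (vanish i) (vanish j).
  move=> x orth_x vi vj.
  move/eqP: orth_x; rewrite mulf_eq0 => /orP[]/eqP.
    by move/vi => ->; rewrite mul0r.
  by move/vj => ->; rewrite mulr0.
Qed.
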